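(* Let $V:\mathbb R^m\times[0,1]\to\mathbb R$ be the (unique) viscosity solution of the Hamilton–Jacobi–Isaacs equation $$\partial_t V(x,t)+H(\nabla_x V(x,t))=0\ \ \text{on }\mathbb R^m\times[0,1),\qquad V(x,1)=g(x)\ \ \forall x\in\mathbb R^m.$$ Then $R^{go}_\infty=V(0,0)$.
   Context: Simple-hypothesis setting: $\mathcal X$ is a finite set, $\Delta_{\mathcal X}$ the probability distributions on $\mathcal X$, $\Delta_K$ the simplex on $[K]$, $D$ the KL divergence. Fix $m\ge2$ bandits $\nu^1,\dots,\nu^m$, $\nu^i=(\nu^i_a)_{a\in[K]}$ with $\nu^i_a\in\Delta_{\mathcal X}$ and $\nu^i_a(x)\ge\epsilon>0$ for all $i,a,x$. For $B\in\mathbb N$, sample paths $Q^B=(Q_1,\dots,Q_B)$ with $Q_l=(Q_{l,a})_a\in(\Delta_{\mathcal X})^K$, $Q^l=(Q_1,\dots,Q_l)$; allocation rules $r^B=(r_1,\dots,r_B)$ with $r_l:((\Delta_{\mathcal X})^K)^l\to\Delta_K$ arbitrary; decision rules $J:((\Delta_{\mathcal X})^K)^B\to[m]$ arbitrary. Define $R^{go}_B=\sup_{r^B,J}\inf_{Q^B}\min_{i\ne J(Q^B)}\frac1B\sum_{l=1}^B\sum_a r_l(Q^l)(a)D(Q_{l,a}\|\nu^i_a)$ and $R^{go}_\infty=\lim_{B\to\infty}R^{go}_B$ (the limit is known to exist). The Hamiltonian is $$H(p)=\min_{Q\in(\Delta_{\mathcal X})^K}\max_{w\in\Delta_K}\sum_{i=1}^m\sum_{a\in[K]}w(a)D(Q_a\|\nu^i_a)p_i,\quad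 p\in\mathbb R^m,$$ and the terminal function is $g(x)=\max_{j\in[m]}\min_{i\ne j}x_i$ (the second smallest coordinate of $x$). *)

(* Defs.v *)
From HB Require Import structures.
From mathcomp Require Import all_boot all_order all_algebra.
From mathcomp Require Import all_classical all_reals all_analysis.
Set Implicit Arguments. Unset Strict Implicit. Unset Printing Implicit Defensive.
Import Order.TTheory GRing.Theory Num.Theory.
Import numFieldNormedType.Exports.
Local Open Scope classical_set_scope.
Local Open Scope ring_scope.

Section Defs.
Variable R : realType.

Definition is_dist (T : finType) (p : T -> R) : Prop :=
  (forall x, 0 <= p x) /\ \sum_(x : T) p x = 1.

(* KL divergence D(q || nu) on a finite set, with 0 log 0 = 0
   (nu will always be strictly positive) *)
Definition KL (X : finType) (q nu : X -> R) : R :=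
  \sum_(x : X) (if q x == 0 then 0 else q x * ln (q x / nu x)).

Definition profile (X : finType) (K : nat) := 'I_K -> X -> R.

(* Hamiltonian H(p) = min_Q max_w sum_i sum_a w(a) D(Q_a || nu^i_a) p_i
   (min/max are attained; written as inf/sup) *)
Definition Ham (X : finType) (m K : nat) (nu : 'I_m -> 'I_K -> X -> R)
  (p : 'rV[R]_m) : R :=
  inf [set h | exists Q : profile X K, (forall a, is_dist (Q a)) /\
        h = sup [set s | exists w : 'I_K -> R, is_dist w /\
               s = \sum_(i < m) \sum_(a < K) w a * KL (Q a) (nu i a) * p 0 i]].

Definition gterm (m : nat) (x : 'rV[R]_m) : R :=
  sup [set v | exists j : 'I_m,
         v = inf [set y | exists i : 'I_m, i != j /\ y = x 0 i]].

(* R^{go}_B.  An allocation rule r^B = (r_1,...,r_B) is encoded as one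
   function on finite sequences of profiles: r_l = r restricted to
   sequences of length l.  The sample path Q^B is a map 'I_B -> profile,
   and Q^l (l = i+1 for i : 'I_B) is the list of its first l entries. *)
Definition Rgo (X : finType) (m K : nat) (nu : 'I_m -> 'I_K -> X -> R)
  (B : nat) : R :=
  sup [set v | exists (r : seq (profile X K) -> 'I_K -> R)
                      (J : ('I_B -> profile X K) -> 'I_m),
        (forall s, is_dist (r s)) /\
        v = inf [set u | exists Qp : 'I_B -> profile X K,
               (forall l a, is_dist (Qp l a)) /\
               u = inf [set d | exists i : 'I_m, i != J Qp /\
                  d = B%:R^-1 * \sum_(l < B) \sum_(a < K)
                        r (take l.+1 [seq Qp j | j <- enum 'I_B]) a
                          * KL (Qp l a) (nu i a)]]].

Definition C1 (m : nat) (phi : 'rV[R]_m * R -> R) : Prop :=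
  (forall v z, derivable phi z v) /\
  (forall v, continuous (fun z => derive phi z v)).

Definition grad_x (m : nat) (phi : 'rV[R]_m * R -> R) (z : 'rV[R]_m * R)
  : 'rV[R]_m := \row_i derive phi z (delta_mx 0 i, 0).

Definition d_t (m : nat) (phi : 'rV[R]_m * R -> R) (z : 'rV[R]_m * R) : R :=
  derive phi z (0, 1).

Definition viscosity_solution (m : nat) (H : 'rV[R]_m -> R)
  (g : 'rV[R]_m -> R) (V : 'rV[R]_m -> R -> R) : Prop :=
  {within [set z : 'rV[R]_m * R | 0 <= z.2 <= 1],
     continuous (fun z => V z.1 z.2)} /\
  (forall x, V x 1 = g x) /\
  (forall phi : 'rV[R]_m * R -> R, C1 phi -> forall (x : 'rV[R]_m) (t : R), 0 < t < 1 ->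
     (\forall z \near ((x, t) : 'rV[R]_m * R), V z.1 z.2 - phi z <= V x t - phi (x, t)) ->
     0 <= d_t phi (x, t) + H (grad_x phi (x, t))) /\
  (forall phi : 'rV[R]_m * R -> R, C1 phi -> forall (x : 'rV[R]_m) (t : R), 0 < t < 1 ->
     (\forall z \near ((x, t) : 'rV[R]_m * R), V x t - phi (x, t) <= V z.1 z.2 - phi z) ->
     d_t phi (x, t) + H (grad_x phi (x, t)) <= 0).

End Defs.

(* Main.v *)
Require Import Defs.
From HB Require Import structures.
From mathcomp Require Import all_boot all_order all_algebra.
From mathcomp Require Import all_classical all_reals all_analysis.
From mathcomp Require Import ring lra.
Import Order.TTheory GRing.Theory Num.Theory.
Import numFieldNormedType.Exports.
Local Open Scope classical_set_scope.
Local Open Scope ring_scope.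

(** The value of the [N]-round game satisfies a dynamic programming recursion:
    with [k] rounds left and rescaled cumulative divergence [x], the value is
    [value k.+1 x = inf_Q sup_w value k (x + N^-1 *: d(Q, w))] and
    [value 0 = g]. This is a monotone scheme consistent with the
    Hamilton-Jacobi-Isaacs equation, and its convergence to [V] is obtained by
    doubling the variables in the style of Crandall and Lions. The divergences
    lie in [[0, C]], so information propagates at speed at most [C] and a sum of
    exponentials moving at that speed localizes the argument to a box, whatever
    the growth of [V]. The same exponentials keep the maximum point away from
    [t = 0] and provide the strict inequality that yields the contradiction. *)

(** * Differentiable test functions: a quadratic penalty and an exponential barrier *)

Section TestFunctions.
Variables (R : realType) (m : nat).
Implicit Types (phi : 'rV[R]_m * R -> R) (z v : 'rV[R]_m * R).

(** The derivative is carried as an explicit function [D], so that sums and compositions keep closed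
    forms from which [d_t] and [grad_x] are read off. *)
Definition C1_with phi (D : 'rV[R]_m * R -> 'rV[R]_m * R -> R) : Prop :=
  (forall z v, is_derive z v phi (D z v)) /\
  (forall v, continuous (fun z => D z v)).

Lemma C1_with_C1 phi D : C1_with phi D -> C1 phi.
Proof.
move=> [dphi cD]; split => [v z|v]; first by have [] := dphi z v.
have -> : (fun z => derive phi z v) = (fun z => D z v).
  by apply/funext => z; have [] := dphi z v.
exact: cD.
Qed.

Lemma C1_C1_with phi : C1 phi -> C1_with phi (fun z v => derive phi z v).
Proof. by move=> [dphi cphi]; split => // z v; exact: DeriveDef. Qed.

Lemma C1_with_derive phi D z v : C1_with phi D -> derive phi z v = D z v.
Proof. by move=> [dphi _]; have [] := dphi z v. Qed.

Lemma C1_withD phi psi D E : C1_with phi D -> C1_with psi E ->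
  C1_with (fun z => phi z + psi z) (fun z v => D z v + E z v).
Proof.
move=> [dphi cD] [dpsi cE]; split => [z v|v].
  exact: (@is_deriveD _ _ _ phi psi).
by move=> z; apply: cvgD; [exact: cD|exact: cE].
Qed.

Lemma C1_withN phi D : C1_with phi D ->
  C1_with (fun z => - phi z) (fun z v => - D z v).
Proof.
move=> [dphi cD]; split => [z v|v].
  exact: (@is_deriveN _ _ _ phi).
by move=> z; apply: cvgN; exact: cD.
Qed.

Lemma continuous_sum n (f : 'I_n -> 'rV[R]_m * R -> R) :
  (forall i, continuous (f i)) -> continuous (fun z => \sum_(i < n) f i z).
Proof.
move=> cf; elim: n => [|n IHn] in f cf *.
  have -> : (fun z => \sum_(i < 0) f i z) = cst 0.
    by apply/funext => z; rewrite big_ord0.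
  exact: cst_continuous.
have -> : (fun z => \sum_(i < n.+1) f i z) =
          (fun z => \sum_(i < n) f (widen_ord (leqnSn n) i) z + f ord_max z).
  by apply/funext => z; rewrite big_ord_recr.
by move=> z; apply: cvgD; [apply: IHn|exact: cf].
Qed.

Lemma C1_with_sum n (phi : 'I_n -> 'rV[R]_m * R -> R) D :
  (forall i, C1_with (phi i) (D i)) ->
  C1_with (fun z => \sum_(i < n) phi i z) (fun z v => \sum_(i < n) D i z v).
Proof.
move=> dphi; split => [z v|v].
  have -> : (fun z => \sum_(i < n) phi i z) = \sum_(i < n) phi i.
    by apply/funext => w; rewrite fct_sumE.
  apply: is_derive_sum => i; exact: (dphi i).1.
by apply: continuous_sum => i; exact: (dphi i).2.
Qed.

(** On the line through [z] in direction [v] the affine map [L] becomes [h * l v + L z], which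
    reduces the directional derivative to the one-variable chain rule. *)
Lemma C1_with_comp (f f' : R -> R) (L l : 'rV[R]_m * R -> R) :
  (forall x : R, is_derive x 1 f (f' x)) -> continuous f' -> continuous L ->
  (forall h v z, L (h *: v + z) = h * l v + L z) ->
  C1_with (fun z => f (L z)) (fun z v => l v * f' (L z)).
Proof.
move=> df cf' cL affL; split => [z v|v z].
  have dg : is_derive (0 : R) 1 (fun h : R => h * l v + L z) (l v).
    apply: is_derive_eq; last by rewrite addr0 scaler0 add0r; exact: mulr1.
  have dfg : is_derive (0 : R) 1 (f \o (fun h : R => h * l v + L z))
      (f' (L z) * l v).
    apply: is_derive1_comp dg; rewrite mul0r add0r; exact: df.
  have [ex_dfg v_dfg] := dfg.
  have E : (fun h : R => f (L (h *: v + z))) =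
           (f \o (fun h : R => h * l v + L z)).
    by apply/funext => h /=; rewrite affL.
  split; first by apply/derivable1P; rewrite E.
  rewrite mulrC -v_dfg -E /derive.
  suff -> : (fun h : R => h^-1 *: (((fun h => f (L (h *: v + z))) \o shift 0)
        (h *: 1) - f (L (0 *: v + z)))) =
      (fun h => h^-1 *: (((fun z => f (L z)) \o shift z) (h *: v) - f (L z))).
    by [].
  by apply/funext => h /=; rewrite [h *: 1]mulr1 addr0 scale0r add0r.
apply: cvgM; first exact: cvg_cst.
exact: (@continuous_comp _ _ _ L f' z (cL z) (cf' (L z))).
Qed.

(** Penalty tying the point [z], where [V] is tested, to the point [(y, s)] of the scheme. The
    factor [(2 * eps)^-1] makes its gradient in [z] equal to [eps^-1] times the difference of the
    two points. *)
Definition quad (eps : R) (z : 'rV[R]_m * R) (y : 'rV[R]_m) (s : R) : R :=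
  \sum_(i < m) (2 * eps)^-1 * (z.1 0 i - y 0 i) ^+ 2 +
  (2 * eps)^-1 * (z.2 - s) ^+ 2.

(* The first sum moves at speed [C], so that its time derivative absorbs the
   change it induces in a Hamiltonian with velocities in [[0, C]^m]; the last
   term decreases in time and makes the resulting inequality strict. *)
Definition barrier (C lam tau : R) (z : 'rV[R]_m * R) : R :=
  \sum_(i < m) expR (lam * (z.1 0 i - C * z.2 - tau)) +
  \sum_(i < m) expR (lam * (- z.1 0 i - tau)) + expR (lam * (tau - z.2)).

(** All terms are nonnegative, so one large exponent suffices. This makes the barrier high on the
    lateral faces of a box and at [t = 0]. *)
Lemma barrier_ge (C lam tau b : R) z :
  (exists i, b <= lam * (z.1 0 i - C * z.2 - tau)) \/
  (exists i, b <= lam * (- z.1 0 i - tau)) \/ b <= lam * (tau - z.2) ->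
  expR b <= barrier C lam tau z.
Proof.
have sum_ge (f : 'I_m -> R) i : b <= f i -> expR b <= \sum_(j < m) expR (f j).
  move=> bf; rewrite (bigD1 i)//= -[leLHS]addr0 lerD ?ler_expR//.
  by rewrite sumr_ge0// => j _; exact: expR_ge0.
have sum_ge0 (f : 'I_m -> R) : 0 <= \sum_(j < m) expR (f j).
  by rewrite sumr_ge0// => j _; exact: expR_ge0.
have e0 := expR_ge0 (lam * (tau - z.2)).
rewrite /barrier; set A := \sum_(i < m) _; set B := \sum_(i < m) _.
have A0 : 0 <= A by exact: sum_ge0.
have B0 : 0 <= B by exact: sum_ge0.
case=> [[i /(sum_ge (fun i => lam * (z.1 0 i - C * z.2 - tau))) bi]|].
  by move: bi; rewrite -/A; lra.
case=> [[i /(sum_ge (fun i => lam * (- z.1 0 i - tau))) bi]|].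
  by move: bi; rewrite -/B; lra.
by rewrite -ler_expR; lra.
Qed.

Lemma barrier_ge0 (C lam tau : R) z : 0 <= barrier C lam tau z.
Proof.
by rewrite /barrier !addr_ge0 ?expR_ge0// sumr_ge0// => i _; exact: expR_ge0.
Qed.

Lemma coord1_continuous i : continuous (fun z : 'rV[R]_m * R => z.1 0 i).
Proof.
move=> z; apply: (@continuous_comp _ _ _ fst (fun x : 'rV[R]_m => x 0 i)).
  exact: cvg_fst.
exact: coord_continuous.
Qed.

Lemma coord2_continuous : continuous (fun z : 'rV[R]_m * R => z.2).
Proof. by move=> z; exact: cvg_snd. Qed.

Lemma quad_C1 (eps : R) y s : C1_with (fun z => quad eps z y s)
  (fun z v => \sum_(i < m) v.1 0 i * (eps^-1 * (z.1 0 i - y 0 i)) +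
              v.2 * (eps^-1 * (z.2 - s))).
Proof.
have df (x : R) : is_derive x 1 (fun x : R => (2 * eps)^-1 * x ^+ 2)
    (eps^-1 * x).
  apply: is_derive_eq.
  rewrite /GRing.scale/= !mulr1 invfM.
  by move: (eps^-1) => e; field.
have cf' : continuous (fun x : R => eps^-1 * x).
  by move=> x; apply: cvgM; [exact: cvg_cst|exact: cvg_id].
apply: C1_withD.
  apply: C1_with_sum => i.
  apply: (C1_with_comp (fun x : R => (2 * eps)^-1 * x ^+ 2) _
    (fun z => z.1 0 i - y 0 i) (fun v => v.1 0 i) df cf').
    by move=> z; apply: cvgB; [exact: coord1_continuous|exact: cvg_cst].
  by move=> h v z /=; rewrite !mxE addrA.
apply: (C1_with_comp (fun x : R => (2 * eps)^-1 * x ^+ 2) _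
    (fun z => z.2 - s) (fun v => v.2) df cf').
  by move=> z; apply: cvgB; [exact: coord2_continuous|exact: cvg_cst].
by move=> h v z /=; rewrite addrA.
Qed.

Lemma barrier_C1 (C lam tau : R) : C1_with (barrier C lam tau)
  (fun z v => \sum_(i < m) lam * (v.1 0 i - C * v.2) *
                 expR (lam * (z.1 0 i - C * z.2 - tau)) +
              \sum_(i < m) lam * (- v.1 0 i) *
                 expR (lam * (- z.1 0 i - tau)) +
              lam * (- v.2) * expR (lam * (tau - z.2))).
Proof.
have df (x : R) : is_derive x 1 expR (expR x) by exact: is_derive_expR.
have ce : continuous (@expR R) by exact: continuous_expR.
apply: C1_withD; first apply: C1_withD.
- apply: C1_with_sum => i.
  apply: (C1_with_comp _ _ (fun z => lam * (z.1 0 i - C * z.2 - tau))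
    (fun v => lam * (v.1 0 i - C * v.2)) df ce).
    move=> z; apply: cvgM; first exact: cvg_cst.
    apply: cvgB; last exact: cvg_cst.
    apply: cvgB; first exact: coord1_continuous.
    by apply: cvgM; [exact: cvg_cst|exact: coord2_continuous].
  by move=> h v z /=; rewrite !mxE /GRing.scale/=; ring.
- apply: C1_with_sum => i.
  apply: (C1_with_comp _ _ (fun z => lam * (- z.1 0 i - tau))
    (fun v => lam * (- v.1 0 i)) df ce).
    move=> z; apply: cvgM; first exact: cvg_cst.
    apply: cvgB; last exact: cvg_cst.
    by apply: cvgN; exact: coord1_continuous.
  by move=> h v z /=; rewrite !mxE; ring.
- apply: (C1_with_comp _ _ (fun z => lam * (tau - z.2))
    (fun v => lam * (- v.2)) df ce).
    move=> z; apply: cvgM; first exact: cvg_cst.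
    by apply: cvgB; [exact: cvg_cst|exact: coord2_continuous].
  by move=> h v z /=; rewrite /GRing.scale/=; ring.
Qed.

Lemma continuous_quad eps y s : continuous (fun z => quad eps z y s).
Proof.
have cq (L : 'rV[R]_m * R -> R) : continuous L ->
    continuous (fun z => (2 * eps)^-1 * L z ^+ 2).
  move=> cL z; apply: cvgM; first exact: cvg_cst.
  exact: (cvgM (cL z) (cL z)).
move=> z; apply: cvgD.
  apply: continuous_sum => i; apply: cq => w.
  by apply: cvgB; [exact: coord1_continuous|exact: cvg_cst].
apply: cq => w; by apply: cvgB; [exact: coord2_continuous|exact: cvg_cst].
Qed.

Lemma continuous_barrier C lam tau : continuous (barrier C lam tau).
Proof.
have ce (L : 'rV[R]_m * R -> R) : continuous L ->
    continuous (fun z => expR (lam * L z)).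
  move=> cL z; apply: (@continuous_comp _ _ _ (fun z => lam * L z) expR).
    by apply: cvgM; [exact: cvg_cst|exact: cL].
  exact: continuous_expR.
move=> z; apply: cvgD; first apply: cvgD.
- apply: continuous_sum => i; apply: ce => w.
  apply: cvgB; last exact: cvg_cst.
  apply: cvgB; first exact: coord1_continuous.
  by apply: cvgM; [exact: cvg_cst|exact: coord2_continuous].
- apply: continuous_sum => i; apply: ce => w.
  apply: cvgB; last exact: cvg_cst.
  by apply: cvgN; exact: coord1_continuous.
- by apply: ce => w; apply: cvgB; [exact: cvg_cst|exact: coord2_continuous].
Qed.

End TestFunctions.

(** * The repeated game in abstract form: the adversary picks [s], the player answers [t], and the
    state moves by [h *: drift s t] *)

Section Game.
Variables (R : realType) (m : nat) (S T : Type) (PS : S -> Prop) (PT : T -> Prop).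
Variables (drift : S -> T -> 'rV[R]_m) (C : R) (s0 : S) (t0 : T).
Hypotheses (C0 : 0 <= C) (PS0 : PS s0) (PT0 : PT t0).

Definition cube (d : 'rV[R]_m) : Prop := forall i, 0 <= d 0 i <= C.

Hypothesis drift_cube : forall s t, PS s -> PT t -> cube (drift s t).

Definition bounded_on_cube (f : 'rV[R]_m -> R) : Prop :=
  exists M, forall d, cube d -> `|f d| <= M.

Definition supT (f : 'rV[R]_m -> R) (s : S) : R :=
  sup [set v | exists t, PT t /\ v = f (drift s t)].

Definition infsup (f : 'rV[R]_m -> R) : R :=
  inf [set v | exists s, PS s /\ v = supT f s].

Lemma supT_ub f s t : bounded_on_cube f -> PS s -> PT t ->
  f (drift s t) <= supT f s.
Proof.
move=> [M fM] Ps Pt; apply: ub_le_sup; last by exists t.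
by exists M => _ [u [Pu ->]]; apply: le_trans (ler_norm _) (fM _ _);
  exact: drift_cube.
Qed.

Lemma supT_le f s a : (forall t, PT t -> f (drift s t) <= a) -> supT f s <= a.
Proof.
move=> fa; apply: ge_sup; first by exists (f (drift s t0)), t0.
by move=> _ [t [Pt ->]]; exact: fa.
Qed.

Lemma infsup_lb f s : bounded_on_cube f -> PS s -> infsup f <= supT f s.
Proof.
move=> bf Ps; apply: ge_inf; last by exists s.
have [M fM] := bf.
exists (- M) => _ [u [Pu ->]]; apply: le_trans (supT_ub _ _ t0 bf Pu PT0).
by have := fM _ (drift_cube _ _ Pu PT0); rewrite ler_norml => /andP[].
Qed.

Lemma infsup_ge f a : (forall s, PS s -> a <= supT f s) -> a <= infsup f.
Proof.
move=> af; apply: lb_le_inf; first by exists (supT f s0), s0.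
by move=> _ [s [Ps ->]]; exact: af.
Qed.

Lemma infsup_near f e : bounded_on_cube f -> 0 < e ->
  exists2 s, PS s & supT f s < infsup f + e.
Proof.
move=> bf e0; apply: contrapT => nex.
suff : infsup f + e <= infsup f by rewrite gerDl leNgt e0.
apply: infsup_ge => s Ps; rewrite leNgt; apply/negP => lts.
by apply: nex; exists s.
Qed.

Lemma supT_near f s e : 0 < e -> exists2 t, PT t & supT f s - e < f (drift s t).
Proof.
move=> e0; apply: contrapT => nex.
suff : supT f s <= supT f s - e by lra.
apply: supT_le => t Pt; rewrite leNgt; apply/negP => lts.
by apply: nex; exists t.
Qed.

(** Only values on the cube matter, since the drift stays there, and [infsup] respects increasing
    affine maps. This compares one round of the game with the Hamiltonian. *)
Lemma infsup_affine_le f F c h : 0 < h ->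
  bounded_on_cube f -> bounded_on_cube F ->
  (forall d, cube d -> c + h * f d <= F d) -> c + h * infsup f <= infsup F.
Proof.
move=> h0 bf bF fF; apply: infsup_ge => s Ps.
apply: (@le_trans _ _ (c + h * supT f s)).
  by rewrite lerD2l ler_pM2l//; exact: infsup_lb.
suff : supT f s <= (supT F s - c) / h.
  by rewrite ler_pdivlMr// mulrC lerBrDl.
apply: supT_le => t Pt; rewrite ler_pdivlMr// mulrC lerBrDl.
apply: le_trans (supT_ub _ _ t bF Ps Pt).
exact/fF/drift_cube.
Qed.

Lemma infsup_affine_ge f F c h : 0 < h ->
  bounded_on_cube f -> bounded_on_cube F ->
  (forall d, cube d -> F d <= c + h * f d) -> infsup F <= c + h * infsup f.
Proof.
move=> h0 bf bF fF.
(* The previous lemma, with [f] and [F] exchanged and the affine map inverted. *)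
have : - (h^-1 * c) + h^-1 * infsup F <= infsup f.
  apply: infsup_affine_le => //; first by rewrite invr_gt0.
  move=> d /fF Fd; rewrite addrC -mulrBr.
  by rewrite mulrC ler_pdivrMr// lerBlDl [f d * h]mulrC.
by rewrite addrC -mulrBr mulrC ler_pdivrMr// lerBlDl [_ * h]mulrC.
Qed.

Lemma infsup_le_shift f F c : bounded_on_cube f -> bounded_on_cube F ->
  (forall d, cube d -> f d <= F d + c) -> infsup f <= infsup F + c.
Proof.
move=> bf bF fF; rewrite [_ + c]addrC -[infsup F]mul1r.
by apply: infsup_affine_ge => // d /fF; rewrite mul1r addrC.
Qed.

Lemma infsup_bounds f a b : (forall d, cube d -> a <= f d <= b) ->
  a <= infsup f <= b.
Proof.
move=> fab.
have bf : bounded_on_cube f.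
  exists (`|a| + `|b|) => d /fab/andP[ad db].
  have := lerNnormlW (lexx `|a|); have := ler_norm b; rewrite ler_norml.
  by have := normr_ge0 a; have := normr_ge0 b; lra.
apply/andP; split.
  apply: infsup_ge => s Ps; apply: le_trans (supT_ub _ _ t0 bf Ps PT0).
  by have /andP[] := fab _ (drift_cube _ _ Ps PT0).
apply: le_trans (infsup_lb _ _ bf PS0) _.
by apply: supT_le => t Pt; have /andP[] := fab _ (drift_cube _ _ PS0 Pt).
Qed.

Lemma bounded_on_cube_dot (p : 'rV[R]_m) :
  bounded_on_cube (fun d => \sum_(i < m) d 0 i * p 0 i).
Proof.
exists (\sum_(i < m) C * `|p 0 i|) => d cd.
apply: le_trans (ler_norm_sum _ _ _) _; apply: ler_sum => i _.
have /andP[d0 dC] := cd i.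
by rewrite normrM ler_wpM2r// ger0_norm.
Qed.

Definition hamiltonian (p : 'rV[R]_m) : R :=
  infsup (fun d => \sum_(i < m) d 0 i * p 0 i).

(** Velocities lie between [0] and [C], so adding [q] to the momentum costs only the positive parts
    of [q]. The barrier is built to absorb this one-sided cost. *)
Lemma hamiltonian_lip (p q : 'rV[R]_m) :
  hamiltonian (p + q) <= hamiltonian p + C * \sum_(i < m) Num.max (q 0 i) 0.
Proof.
apply: infsup_le_shift; do ?exact: bounded_on_cube_dot.
move=> d cd; rewrite mulr_sumr -big_split/=; apply: ler_sum => i _.
rewrite mxE mulrDr lerD2l; have /andP[d0 dC] := cd i.
apply: (@le_trans _ _ (d 0 i * Num.max (q 0 i) 0)).
  by apply: ler_wpM2l => //; rewrite le_max lexx.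
by apply: ler_wpM2r => //; rewrite le_max lexx orbT.
Qed.

Variables (g : 'rV[R]_m -> R) (h : R).
Hypothesis h0 : 0 < h.
Hypothesis g_lip : forall (x y : 'rV[R]_m) c,
  (forall i, x 0 i <= y 0 i + c) -> g x <= g y + c.

Fixpoint value (k : nat) (x : 'rV[R]_m) : R :=
  if k is k'.+1 then infsup (fun d => value k' (x + h *: d)) else g x.

Lemma lip_bounded_on_cube (f : 'rV[R]_m -> R) x :
  (forall (x y : 'rV[R]_m) c,
    (forall i, x 0 i <= y 0 i + c) -> f x <= f y + c) ->
  bounded_on_cube (fun d => f (x + h *: d)).
Proof.
move=> flip; exists (`|f x| + h * C) => d cd.
have /flip : forall i, (x + h *: d) 0 i <= x 0 i + h * C.
  by move=> i; rewrite !mxE lerD2l ler_pM2l//; have /andP[] := cd i.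
have /flip : forall i, x 0 i <= (x + h *: d) 0 i + 0.
  move=> i; rewrite !mxE addr0 lerDl; have /andP[? _] := cd i.
  by rewrite mulr_ge0// ltW.
have hC0 : 0 <= h * C by rewrite mulr_ge0// ltW.
rewrite addr0 => lo up.
have := ler_norm (f x); have := ler_norm (- f x); rewrite normrN => n1 n2.
by rewrite ler_norml; apply/andP; split; lra.
Qed.

(** The one-sided form packs monotonicity ([c = 0]) and non-expansiveness in the maximum norm into
    one statement, which [infsup] preserves. *)
Lemma value_lip k (x y : 'rV[R]_m) c :
  (forall i, x 0 i <= y 0 i + c) -> value k x <= value k y + c.
Proof.
elim: k => [|k IHk] /= in x y c *; first exact: g_lip.
move=> xyc; apply: infsup_le_shift; do ?exact: lip_bounded_on_cube.
move=> d cd; apply: IHk => i; rewrite !mxE.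
by have := xyc i; lra.
Qed.

Lemma value_bounded k x : bounded_on_cube (fun d => value k (x + h *: d)).
Proof. by apply: lip_bounded_on_cube => *; exact: value_lip. Qed.

Lemma value_time k x : value k x <= value k.+1 x <= value k x + h * C.
Proof.
apply: infsup_bounds => d cd; apply/andP; split.
  rewrite -[leRHS]addr0; apply: value_lip => i; rewrite !mxE addr0 lerDl.
  by have /andP[? _] := cd i; rewrite mulr_ge0// ltW.
apply: value_lip => i; rewrite !mxE lerD2l ler_pM2l//.
by have /andP[] := cd i.
Qed.

(** Monotonicity and consistency at once: an affine minorant of slope [p] over the reachable
    displacements passes to the next round through [hamiltonian p]. *)
Lemma value_ge_scheme k y (p : 'rV[R]_m) c :
  (forall d, cube d ->
    c + h * (\sum_(i < m) d 0 i * p 0 i) <= value k (y + h *: d)) ->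
  c + h * hamiltonian p <= value k.+1 y.
Proof.
move=> cf; apply: infsup_affine_le => //.
  exact: bounded_on_cube_dot.
exact: value_bounded.
Qed.

Lemma value_le_scheme k y (p : 'rV[R]_m) c :
  (forall d, cube d ->
    value k (y + h *: d) <= c + h * (\sum_(i < m) d 0 i * p 0 i)) ->
  value k.+1 y <= c + h * hamiltonian p.
Proof.
move=> cf; apply: infsup_affine_ge => //.
  exact: bounded_on_cube_dot.
exact: value_bounded.
Qed.

(** The answer in round [i] is computed from [take i.+1 l], hence sees the adversary's current move
    as well as the past ones. *)
Definition state (r : seq S -> T) (x : 'rV[R]_m) (l : seq S) : 'rV[R]_m :=
  x + h *: \sum_(i < size l) drift (nth s0 l i) (r (take i.+1 l)).

Definition all_PS (l : seq S) : Prop :=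
  forall i, (i < size l)%N -> PS (nth s0 l i).

Lemma state_cons r x q l : state r x (q :: l) =
  state (fun l => r (q :: l)) (x + h *: drift q (r [:: q])) l.
Proof.
by rewrite /state/= big_ord_recl/= take0 scalerDr addrA.
Qed.

(** Induction on the rounds: answer the first move nearly optimally, then follow the strategy for
    the state so reached. Suprema need not be attained, so each round loses [e]. *)
Lemma value_strategy k x e : 0 < e -> exists r : seq S -> T,
  (forall l, PT (r l)) /\
  (forall l, size l = k -> all_PS l -> value k x - k%:R * e <= g (state r x l)).
Proof.
move=> e0; elim: k => [|k IHk] in x *.
  exists (fun _ => t0); split => // l /size0nil -> _.
  by rewrite /state/= big_ord0 scaler0 addr0 mul0r subr0.
have ex_t s : exists t, PT t /\
    (supT (fun d => value k (x + h *: d)) s - e < value k (x + h *: drift s t)).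
  by have [t] := supT_near (fun d => value k (x + h *: d)) s e e0; exists t.
have [w w_spec] := choice ex_t.
have [r r_spec] := choice (fun s => IHk (x + h *: drift s (w s))).
(* A first move [q] is answered by [w q], and the rest of the path is handed to [r q]; [t0] on the
   empty path is a default. *)
pose r' l := if l is q :: l' then (if l' is [::] then w q else r q l') else t0.
exists r'; split.
  by move=> [|q [|q' l]] //=; [have [] := w_spec q|have [] := r_spec q].
move=> [//|q l] [sl] Pl.
rewrite state_cons/=.
have Pq : PS q by apply: (Pl 0).
have -> : state (fun l => r' (q :: l)) (x + h *: drift q (w q)) l =
          state (r q) (x + h *: drift q (w q)) l.
  rewrite /state; congr (_ + _ *: _); apply: eq_bigr => -[i il] _ /=.
  by congr drift; case: l il {sl Pl}.
apply: le_trans ((r_spec q).2 l sl _); last by move=> i il; exact: (Pl i.+1).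
have [_ wq] := w_spec q.
have := infsup_lb _ _ (value_bounded k x) Pq.
by rewrite -natr1 mulrDl mul1r; lra.
Qed.

(** A move [q] nearly attaining the infimum is good against every answer, in particular against [r
    [:: q]]; the remaining rounds are played against [r] with [q] prepended. *)
Lemma value_adversary k x e (r : seq S -> T) : 0 < e -> (forall l, PT (r l)) ->
  exists l, [/\ size l = k, all_PS l &
    g (state r x l) <= value k x + k%:R * e].
Proof.
move=> e0; elim: k => [|k IHk] in x r * => Pr.
  exists [::]; split=> //.
  by rewrite /state/= big_ord0 scaler0 addr0 mul0r addr0.
have [q Pq qe] := infsup_near _ _ (value_bounded k x) e0.
have [l [sl Pl le_l]] := IHk (x + h *: drift q (r [:: q]))
  (fun l => r (q :: l)) (fun l => Pr (q :: l)).
exists (q :: l); split; first by rewrite /= sl.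
  by move=> [|i] //= il; exact: Pl.
rewrite state_cons; apply: le_trans le_l _.
have := supT_ub _ _ _ (value_bounded k x) Pq (Pr [:: q]).
by rewrite -natr1 mulrDl mul1r /=; lra.
Qed.

End Game.

(** * Comparison of a subsolution [V] with a scheme [U] by doubling the variables; [U N k] stands
    for time [1 - k / N] *)

Section Comparison.
Local Arguments quad {R m}.
Local Arguments barrier {R m}.
Local Arguments quad_C1 {R m}.
Local Arguments barrier_C1 {R m}.
Local Arguments cube {R m}.
Variables (R : realType) (m : nat) (H g : 'rV[R]_m -> R) (C : R).
Variables (V : 'rV[R]_m -> R -> R) (U : nat -> nat -> 'rV[R]_m -> R).
Implicit Types (x y p q d : 'rV[R]_m) (z : 'rV[R]_m * R).
Implicit Types (a b c e s t eps eta lam sigma tau : R).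

Hypothesis C0 : 0 <= C.
Hypothesis H_lip : forall p q : 'rV[R]_m,
  H (p + q) <= H p + C * \sum_(i < m) Num.max (q 0 i) 0.
Hypothesis V_cont : {within [set z : 'rV[R]_m * R | 0 <= z.2 <= 1],
  continuous (fun z => V z.1 z.2)}.
Hypothesis V_term : forall x, V x 1 = g x.
Hypothesis V_sub : forall phi : 'rV[R]_m * R -> R, C1 phi ->
  forall (x : 'rV[R]_m) (t : R), 0 < t < 1 ->
  (\forall z \near ((x, t) : 'rV[R]_m * R),
     V z.1 z.2 - phi z <= V x t - phi (x, t)) ->
  0 <= d_t phi (x, t) + H (grad_x phi (x, t)).
Hypothesis U_lip : forall N k (x y : 'rV[R]_m) c, (0 < N)%N ->
  (forall i, `|x 0 i - y 0 i| <= c) -> U N k x <= U N k y + c.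
Hypothesis U_time : forall N k x, (0 < N)%N ->
  `|U N k.+1 x - U N k x| <= N%:R^-1 * C.
Hypothesis U_term : forall N x, U N 0 x = g x.
Hypothesis U_scheme : forall N k (y p : 'rV[R]_m) c, (0 < N)%N ->
  (forall d, cube C d ->
    c + N%:R^-1 * (\sum_(i < m) d 0 i * p 0 i) <= U N k (y + N%:R^-1 *: d)) ->
  c + N%:R^-1 * H p <= U N k.+1 y.

Lemma sum_delta_mx (i : 'I_m) (a : 'I_m -> R) :
  \sum_(j < m) (delta_mx 0 i : 'rV[R]_m) 0 j * a j = a i.
Proof.
rewrite (bigD1 i)//= mxE !eqxx mul1r big1 ?addr0// => j ji.
by rewrite mxE (negbTE ji) andbF mul0r.
Qed.

Lemma young (e a b : R) : 0 < e ->
  a * b <= e / 2 * a ^+ 2 + (2 * e)^-1 * b ^+ 2.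
Proof.
move=> e0; rewrite -subr_ge0.
have -> : e / 2 * a ^+ 2 + (2 * e)^-1 * b ^+ 2 - a * b =
          (2 * e)^-1 * (b - e * a) ^+ 2 by field; lra.
by rewrite mulr_ge0 ?sqr_ge0// invr_ge0; lra.
Qed.

(** The gradient of the barrier has positive parts at most [lam * E i], so by [H_lip] it costs at
    most [C] times their sum. The time derivative of the moving exponentials cancels exactly this;
    only the last exponential remains. *)
Lemma viscosity_at_max eps lam tau x t y s : 0 < lam -> 0 < t < 1 ->
  (\forall z \near ((x, t) : 'rV[R]_m * R),
     V z.1 z.2 - (quad eps z y s + barrier C lam tau z) <=
     V x t - (quad eps (x, t) y s + barrier C lam tau (x, t))) ->
  lam * expR (lam * (tau - t)) <=
  eps^-1 * (t - s) + H (eps^-1 *: (x - y)).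
Proof.
move=> lam0 t01 max_xt.
have phiD := C1_withD _ _ _ _ _ _ (quad_C1 eps y s) (barrier_C1 C lam tau).
have := V_sub _ (C1_with_C1 _ _ _ _ phiD) _ _ t01 max_xt.
set E := fun i : 'I_m => expR (lam * (x 0 i - C * t - tau)).
set F := fun i : 'I_m => expR (lam * (- x 0 i - tau)).
have -> : d_t (fun z => quad eps z y s + barrier C lam tau z) (x, t) =
    eps^-1 * (t - s) - C * (\sum_(i < m) lam * E i) -
    lam * expR (lam * (tau - t)).
  rewrite /d_t (C1_with_derive _ _ _ _ _ _ phiD)/=.
  rewrite big1 ?add0r ?mul1r; last by move=> i _; rewrite mxE mul0r.
  rewrite [X in _ + (_ + X + _)]big1; last first.
    by move=> i _; rewrite mxE oppr0 mulr0 mul0r.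
  rewrite addr0 addrA mulrN1 mulNr; congr (_ + _ - _).
  rewrite mulr_sumr -sumrN; apply: eq_bigr => i _.
  by rewrite mxE mulr1 /E; ring.
pose q : 'rV[R]_m := \row_i (lam * E i - lam * F i).
have -> : grad_x (fun z => quad eps z y s + barrier C lam tau z) (x, t) =
    eps^-1 *: (x - y) + q.
  apply/rowP => i; rewrite !mxE (C1_with_derive _ _ _ _ _ _ phiD)/=.
  rewrite mul0r addr0 oppr0 !mulr0 mul0r addr0 sum_delta_mx; congr (_ + (_ + _)).
    under eq_bigr do rewrite subr0 [lam * _]mulrC -mulrA.
    by rewrite sum_delta_mx.
  rewrite -(sum_delta_mx i (fun j => lam * F j)) -sumrN; apply: eq_bigr => j _.
  by rewrite /F; ring.
have qE : \sum_(i < m) Num.max (q 0 i) 0 <= \sum_(i < m) lam * E i.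
  apply: ler_sum => i _; rewrite mxE ge_max.
  by rewrite gerBl !mulr_ge0 ?expR_ge0// ltW.
have := H_lip (eps^-1 *: (x - y)) q.
by have := ler_wpM2l C0 qE; lra.
Qed.

(** Near-maximality bounds [U N k] from below by a quadratic in the displacement. Its linear part
    has slope [eps^-1 *: (x - y)], to which [U_scheme] applies; the second-order part and the
    tolerance [N^-1 ^+ 2] form the right-hand side. *)
Lemma scheme_at_max N k eps (x y : 'rV[R]_m) t : (0 < N)%N -> 0 < eps ->
  (forall y', U N k.+1 y - U N k y' <=
     quad eps (x, t) y' (1 - k%:R / N%:R) -
     quad eps (x, t) y (1 - k.+1%:R / N%:R) + N%:R^-1 ^+ 2) ->
  eps^-1 * (t - (1 - k.+1%:R / N%:R)) + H (eps^-1 *: (x - y)) <=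
  N%:R^-1 * ((2 * eps)^-1 * (m%:R * C ^+ 2 + 1) + 1).
Proof.
move=> N0 eps0 max_y; set h : R := N%:R^-1 in max_y *.
have h0 : 0 < h by rewrite invr_gt0 ltr0n.
set s := 1 - k.+1%:R * h; set p := eps^-1 *: (x - y).
have sE : 1 - k%:R * h = s + h by rewrite /s -natr1; ring.
rewrite sE in max_y.
set A := (2 * eps)^-1 * (m%:R * C ^+ 2 + 1) + 1.
(* [U N k.+1 y] occurs on both sides; cancelling it and dividing by [h] leaves the claim. *)
suff : U N k.+1 y + h * (eps^-1 * (t - s)) - h * (h * A) + h * H p <= U N k.+1 y.
  rewrite -addrA -addrA gerDl addrCA -mulrN -!mulrDr pmulr_rle0//; lra.
apply: U_scheme => // d cd.
have := max_y (y + h *: d); rewrite /quad /= -/h -/s.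
set q0 := (X in _ <= X -> _).
suff : q0 <= - (h * (eps^-1 * (t - s))) + h * (h * A) -
             h * \sum_(i < m) d 0 i * p 0 i by lra.
rewrite /q0.
have -> : (2 * eps)^-1 * (t - (s + h)) ^+ 2 =
    (2 * eps)^-1 * (t - s) ^+ 2 - h * (eps^-1 * (t - s)) + h ^+ 2 * (2 * eps)^-1.
  by field; lra.
have : \sum_(i < m) (2 * eps)^-1 * (x 0 i - (y + h *: d) 0 i) ^+ 2 <=
    \sum_(i < m) (2 * eps)^-1 * (x 0 i - y 0 i) ^+ 2 -
    h * \sum_(i < m) d 0 i * p 0 i + h ^+ 2 * ((2 * eps)^-1 * (m%:R * C ^+ 2)).
  have -> : h ^+ 2 * ((2 * eps)^-1 * (m%:R * C ^+ 2)) =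
      \sum_(i < m) h ^+ 2 * ((2 * eps)^-1 * C ^+ 2).
    by rewrite sumr_const card_ord -mulr_natl; ring.
  rewrite mulr_sumr -sumrB -big_split/=; apply: ler_sum => i _.
  rewrite !mxE; have /andP[d0 dC] := cd i.
  have -> : (2 * eps)^-1 * (x 0 i - (y 0 i + h * d 0 i)) ^+ 2 =
      (2 * eps)^-1 * (x 0 i - y 0 i) ^+ 2 -
      h * (d 0 i * (eps^-1 * (x 0 i - y 0 i))) +
      h ^+ 2 * ((2 * eps)^-1 * d 0 i ^+ 2) by field; lra.
  rewrite lerD2l ler_wpM2l ?sqr_ge0// ler_wpM2l ?invr_ge0 ?lerXn2r ?nnegrE//.
  by lra.
rewrite /A; set B := (2 * eps)^-1; set m' := m%:R; set q1 := \sum_(i < m) _.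
set q2 := \sum_(i < m) _; set q3 := \sum_(i < m) _.
have -> : h * (h * (B * (m' * C ^+ 2 + 1) + 1)) =
  h ^+ 2 * (B * (m' * C ^+ 2)) + h ^+ 2 * B + h ^+ 2 by ring.
by lra.
Qed.

(* [V] is only continuous on the strip [0 <= t <= 1]. *)
Definition clamp (t : R) : R := Num.max (Num.min t 1) 0.

Lemma clamp_id t : 0 <= t <= 1 -> clamp t = t.
Proof. by move=> /andP[t0 t1]; rewrite /clamp min_l// max_l. Qed.

Lemma clamp_itv t : 0 <= clamp t <= 1.
Proof. by rewrite /clamp le_max lexx orbT/= ge_max ge_min lexx orbT ler01. Qed.

Definition clampV (z : 'rV[R]_m * R) : R := V z.1 (clamp z.2).

Lemma clampV_id x t : 0 <= t <= 1 -> clampV (x, t) = V x t.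
Proof. by move=> t01; rewrite /clampV clamp_id. Qed.

Lemma clampV_continuous : continuous clampV.
Proof.
move=> z.
have cc : (fun z : 'rV[R]_m * R => (z.1, clamp z.2)) @ z --> (z.1, clamp z.2).
  apply: (@cvg_pair _ _ _ (nbhs z) (nbhs z.1) (nbhs (clamp z.2)) _ _ _
    fst (fun z => clamp z.2)); first exact: cvg_fst.
  apply: (@continuous_max _ _ (fun z : 'rV[R]_m * R => Num.min z.2 1) (cst 0) z).
    apply: (@continuous_min _ _ (fun z : 'rV[R]_m * R => z.2) (cst 1) z).
      exact: cvg_snd.
    exact: cvg_cst.
  exact: cvg_cst.
have /subspace_continuousP/(_ (z.1, clamp z.2) (clamp_itv _)) cV := V_cont.
move=> P /cV nP.
have := cc _ nP; apply: (@filterS _ (nbhs z) _) => w /=; apply; exact: clamp_itv.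
Qed.

Lemma U_time_le N j k x : (0 < N)%N ->
  `|U N (k + j) x - U N k x| <= j%:R / N%:R * C.
Proof.
move=> N0; elim: j => [|j IHj]; first by rewrite addn0 subrr normr0 !mul0r.
rewrite addnS -natr1 !mulrDl mul1r -mulrA.
have -> : U N (k + j).+1 x - U N k x =
  (U N (k + j) x - U N k x) + (U N (k + j).+1 x - U N (k + j) x) by ring.
by rewrite (le_trans (ler_normD _ _))// lerD// ?mulrA// U_time.
Qed.

Lemma U_ge_term N k x : (0 < N)%N -> g x <= U N k x + k%:R / N%:R * C.
Proof.
move=> N0; have := U_time_le N k 0 x N0.
by rewrite add0n U_term => /lerNnormlW; lra.
Qed.

(** Young's inequality replaces the Lipschitz bound by the space part of [quad], so [y] can be
    traded for [x] at the cost [eps / 2]. *)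
Lemma U_lip_quad N k (x y : 'rV[R]_m) eps : (0 < N)%N -> 0 < eps ->
  U N k x <= U N k y +
    (eps / 2 + \sum_(i < m) (2 * eps)^-1 * (x 0 i - y 0 i) ^+ 2).
Proof.
move=> N0 eps0; apply: U_lip => // i.
have := young eps 1 `|x 0 i - y 0 i| eps0.
rewrite mul1r expr1n mulr1 real_normK ?num_real// => /le_trans; apply.
rewrite lerD2l (bigD1 i)//= lerDl sumr_ge0// => j _.
by rewrite mulr_ge0 ?sqr_ge0// invr_ge0; lra.
Qed.

(** Time is doubled as well: [z.2] is continuous, while the scheme keeps its own clock
    [1 - k / N]. *)
Definition penalized N eps lam tau z y k : R :=
  clampV z - U N k y - quad eps z y (1 - k%:R / N%:R) - barrier C lam tau z.

Lemma penalized_le N eps lam tau z y k : (0 < N)%N -> 0 < eps ->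
  penalized N eps lam tau z y k <= clampV z - U N k z.1 + eps / 2 -
    (2 * eps)^-1 * (z.2 - (1 - k%:R / N%:R)) ^+ 2 - barrier C lam tau z.
Proof.
move=> N0 eps0; rewrite /penalized /quad.
by have := U_lip_quad N k z.1 y eps N0 eps0; lra.
Qed.

(** The bounds are such that, for [lam > 0], some exponent of [barrier] is at least [lam * tau] on
    every lateral face and at [t = 0]. *)
Definition box tau : set ('rV[R]_m * R) :=
  [set x : 'rV[R]_m | forall i,
     `[- (2 * tau), C + 2 * tau]%classic (x ord0 i)] `*` `[0, 1].

Lemma box_compact tau : compact (box tau).
Proof.
apply: compact_setX; last exact: segment_compact.
apply: (@rV_compact R m (fun=> `[- (2 * tau), C + 2 * tau]%classic)) => i.
exact: segment_compact.
Qed.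

Lemma boxP tau z : box tau z <->
  (forall i, - (2 * tau) <= z.1 0 i <= C + 2 * tau) /\ 0 <= z.2 <= 1.
Proof.
split=> -[zx zt]; split => //=; try (move=> i; have := zx i);
  by rewrite /= in_itv.
Qed.

Lemma box0 tau t : 0 <= tau -> 0 <= t <= 1 -> box tau (0, t).
Proof.
move=> tau0 t01; apply/boxP; split => //= i.
have -> : (0 : 'rV[R]_m) 0 i = 0 :> R by rewrite mxE.
by have := C0; lra.
Qed.

Lemma box_nbhs tau (x : 'rV[R]_m) t :
  (forall i, - (2 * tau) < x 0 i < C + 2 * tau) -> 0 < t < 1 ->
  \forall z \near ((x, t) : 'rV[R]_m * R), box tau z.
Proof.
move=> x_in /andP[t0 t1].
have ct := coord2_continuous R m (x, t).
have near_x (i : 'I_m) : \forall z \near ((x, t) : 'rV[R]_m * R),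
    - (2 * tau) < (z : 'rV[R]_m * R).1 0 i < C + 2 * tau.
  have /andP[lo up] := x_in i.
  have cx := coord1_continuous R m i (x, t).
  near=> z; apply/andP; split; near: z.
    exact: cvgr_gt cx _ lo.
  exact: cvgr_lt cx _ up.
near=> z; apply/boxP; split.
  move=> i; suff /andP[? ?] : - (2 * tau) < z.1 0 i < C + 2 * tau.
    by rewrite !ltW.
  by move: i; near: z; exact: filter_forall.
apply/andP; split; apply: ltW; near: z.
  exact: cvgr_gt ct _ t0.
exact: cvgr_lt ct _ t1.
Unshelve. all: by end_near. Qed.

Lemma clampV_term (x : 'rV[R]_m) : clampV (x, 1) = g x.
Proof. by rewrite clampV_id ?V_term// ler01 lexx. Qed.

(** The points of the box where [V] exceeds the terminal value by at least [c] form a compact set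
    disjoint from [t = 1]; the latest of them gives [eta]. *)
Lemma near_terminal tau c : 0 < c -> exists2 eta, 0 < eta &
  forall z, box tau z -> c <= clampV z - g z.1 -> eta <= 1 - z.2.
Proof.
move=> c0.
pose f (z : 'rV[R]_m * R) := clampV z - clampV (z.1, 1).
have cf : continuous f.
  move=> z; apply: cvgB; first exact: clampV_continuous.
  apply: (@continuous_comp _ _ _ (fun z : 'rV[R]_m * R => (z.1, 1 : R)) clampV).
    by apply: (@cvg_pair _ _ _ (nbhs z) (nbhs z.1) (nbhs (1 : R)) _ _ _
      fst (cst 1)); [exact: cvg_fst|exact: cvg_cst].
  exact: clampV_continuous.
have cK : compact (box tau `&` f @^-1` [set y | c <= y]).
  apply: compact_closedI; first exact: box_compact.
  by apply: preimage_closed; [move=> z _; exact: cf|exact: closed_ge].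
have [K0|/set0P K0] := eqVneq (box tau `&` f @^-1` [set y | c <= y]) set0.
  exists 1 => // z bz fz.
  suff : set0 z by [].
  by rewrite -K0; split => //=; rewrite /f clampV_term.
have c2 : {within box tau `&` f @^-1` [set y | c <= y],
    continuous (fun z : 'rV[R]_m * R => z.2)}.
  exact/continuous_subspaceT/coord2_continuous.
have [z0 z0K z0max] := compact_EVT_max K0 cK c2.
have [bz0 fz0] := set_mem z0K.
exists (1 - z0.2) => [|z bz fz].
  have [_ /andP[_ t1]] := (boxP _ _).1 bz0.
  rewrite subr_gt0 lt_neqAle t1 andbT; apply/eqP => z02.
  move: fz0; rewrite /f /= -z02 -surjective_pairing subrr => c_le0.
  by have := lt_le_trans c0 c_le0; rewrite ltxx.
rewrite lerD2l lerN2; apply: z0max; apply: mem_set; split => //=.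
by rewrite /f clampV_term.
Qed.

(* The scheme tolerates an error [N^-1 ^+ 2], so only the maximum in [z], where
   [V] is tested, needs to be attained. *)
Lemma penalized_max N eps lam tau B : (0 < N)%N -> box tau !=set0 ->
  (forall z y k, box tau z -> (k <= N)%N -> penalized N eps lam tau z y k <= B) ->
  exists z y k, [/\ box tau z, (k <= N)%N,
    (forall z', box tau z' ->
       penalized N eps lam tau z' y k <= penalized N eps lam tau z y k) &
    (forall z' y' k', box tau z' -> (k' <= N)%N ->
       penalized N eps lam tau z' y' k' <=
       penalized N eps lam tau z y k + N%:R^-1 ^+ 2)].
Proof.
move=> N0 [zb bzb] PB.
pose E := [set v | exists z y k, [/\ box tau z, (k <= N)%N &
  v = penalized N eps lam tau z y k]].
have ubE : has_ubound E by exists B => _ [z [y [k [bz kN ->]]]]; exact: PB.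
have supE : has_sup E.
  by split => //; exists (penalized N eps lam tau zb 0 0), zb, 0, 0%N.
have h2 : 0 < N%:R^-1 ^+ 2 :> R by rewrite exprn_gt0// invr_gt0 ltr0n.
have [_ [z1 [y [k [bz1 kN ->]]]] near_sup] := sup_adherent h2 supE.
have cP : {within box tau,
    continuous (fun z => penalized N eps lam tau z y k)}.
  apply: continuous_subspaceT => z; rewrite /penalized.
  apply: cvgB; last exact: continuous_barrier.
  apply: cvgB; last exact: continuous_quad.
  by apply: cvgB; [exact: clampV_continuous|exact: cvg_cst].
have [z /set_mem bz z_max] :=
  compact_EVT_max (ex_intro _ _ bzb) (box_compact tau) cP.
exists z, y, k; split => //.
  by move=> z' bz'; apply: z_max; exact: mem_set.
move=> z' y' k' bz' kN'.
have := ub_le_sup ubE (ex_intro _ z' (ex_intro _ y' (ex_intro _ k' (And3 bz' kN' erefl)))).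
have := z_max _ (mem_set bz1).
by move: near_sup; lra.
Qed.

Lemma grid_point N t : (0 < N)%N -> 0 <= t <= 1 ->
  exists2 k, (k <= N)%N & `|t - (1 - k%:R / N%:R)| <= N%:R^-1 :> R.
Proof.
move=> N0 /andP[t0 t1].
have N0' : 0 < N%:R :> R by rewrite ltr0n.
have a0 : 0 <= (1 - t) * N%:R by rewrite mulr_ge0//; lra.
have /andP[lo up] := truncn_itv a0.
set k := Num.truncn _ in lo up.
exists k.
  rewrite -(ler_nat R); apply: le_trans lo _.
  by rewrite ler_piMl ?(ltW N0')//; lra.
rewrite -(ler_pM2r N0') mulVf ?gt_eqF//.
rewrite -[X in _ * X <= _](gtr0_norm N0') -normrM.
have -> : (t - (1 - k%:R / N%:R)) * N%:R = k%:R - (1 - t) * N%:R.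
  by field; rewrite gt_eqF.
by rewrite ler_norml; move: lo up; rewrite -natr1; lra.
Qed.

Lemma near0_mul_le (a b : R) : 0 < b -> \forall x \near (0 : R)^'+, a * x <= b.
Proof.
move=> b0; near=> x.
have x0 : 0 < x by [].
have a1 : 0 < `|a| + 1 by rewrite ltr_pwDr.
have : x <= b / (`|a| + 1).
  near: x; apply: nbhs_right_le; exact: divr_gt0.
rewrite ler_pdivlMr// => xb; apply: le_trans xb.
rewrite mulrC ler_pM2l//.
by have := ler_norm a; lra.
Unshelve. all: by end_near. Qed.

Lemma near_infty_inv (P : set R) : (\forall x \near (0 : R)^'+, P x) ->
  \forall N \near \oo, (0 < N)%N /\ P N%:R^-1.
Proof.
rewrite /at_right/= => -[e /= e0 Pe].
near=> N.
have N0 : (0 < N)%N by near: N; exact: nbhs_infty_gt.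
split=> //; apply: Pe; last by rewrite /= invr_gt0 ltr0n.
rewrite /= sub0r normrN gtr0_norm ?invr_gt0 ?ltr0n//.
rewrite invf_plt ?posrE ?ltr0n//.
by near: N; exact: nbhs_infty_gtr.
Unshelve. all: by end_near. Qed.

Lemma clampV_bounded tau : 0 < tau ->
  exists2 M : R, 0 <= M & forall z, box tau z -> `|clampV z| <= M.
Proof.
move=> tau0.
have b0 : box tau !=set0.
  by exists (0, 0); apply: box0; lra.
have cn : {within box tau, continuous (fun z => `|clampV z|)}.
  apply: continuous_subspaceT => z; apply: cvg_norm; exact: clampV_continuous.
have [z _ z_max] := compact_EVT_max b0 (box_compact tau) cn.
by exists `|clampV z| => // w bw; apply: z_max; exact: mem_set.
Qed.

(** Since the barrier is high at [t = 0], the comparison starts at time [2 * tau]; continuity of [V]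
    and the speed bound [C] make this delay cheap. *)
Lemma small_time sigma : 0 < sigma -> exists tau, [/\ 0 < tau, tau <= 1 / 4,
  C * (2 * tau) <= sigma / 8 & `|clampV (0, 0) - clampV (0, 2 * tau)| < sigma / 8].
Proof.
move=> sigma0.
have c2 : clampV (0, 2 * t) @[t --> (0 : R)^'+] --> clampV (0, 2 * 0).
  apply: cvg_at_right_filter.
  apply: (@continuous_comp _ _ _ (fun t : R => (0 : 'rV[R]_m, 2 * t)) clampV).
    apply: (@cvg_pair _ _ _ (nbhs (0 : R)) (nbhs (0 : 'rV[R]_m))
      (nbhs (2 * 0 : R)) _ _ _ (cst 0) (fun t => 2 * t)); first exact: cvg_cst.
    by apply: cvgM; [exact: cvg_cst|exact: cvg_id].
  exact: clampV_continuous.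
have s8 : 0 < sigma / 8 by lra.
near (0 : R)^'+ => tau; exists tau; split.
- by [].
- by near: tau; apply: nbhs_right_le; lra.
- rewrite mulrA; near: tau; exact: near0_mul_le.
- near: tau; move/cvgrPdist_lt : c2 => /(_ _ s8); rewrite mulr0; exact.
Unshelve. all: by end_near. Qed.

(** The constants are fixed in the order [tau], [M], [eta], [lam], [eps], with [N] taken large last.
    If the bound failed, a near-maximum of [penalized] would be positive, hence interior, where the
    viscosity and scheme inequalities are incompatible. *)
Theorem subsolution_le_value sigma : 0 < sigma ->
  \forall N \near \oo, V 0 0 <= U N N 0 + sigma.
Proof.
move=> sigma0; have C_ge0 := C0.
have [tau [tau0 tau4 tauC tauV]] := small_time sigma sigma0.
have [M M0 VM] := clampV_bounded tau tau0.
have s8 : 0 < sigma / 8 by lra.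
have s16 : 0 < sigma / 16 by lra.
have [eta eta0 etaP] := near_terminal tau (sigma / 8) s8.
(* The first three terms bound [penalized] plus [barrier], which keeps a positive near-maximum off
   the faces, where the barrier is at least [expR L]. The last term makes the barrier at most
   [sigma / 8] at the starting point. *)
pose L := 2 * M + C + 1 + 8 * (2 * m%:R + 1) / sigma.
pose lam := L / tau.
have m0 : 0 <= m%:R :> R by [].
have L2 : 0 < 8 * (2 * m%:R + 1) / sigma by rewrite divr_gt0//; lra.
have L0 : 0 < L by rewrite /L; lra.
have lam0 : 0 < lam by exact: divr_gt0.
have lamtau : lam * tau = L by rewrite /lam divfK// gt_eqF.
have expL : L < expR L by apply: lt_le_trans (expR_ge1Dx L); lra.
have expNL : (2 * m%:R + 1) * expR (- L) <= sigma / 8.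
  rewrite expRN ler_pdivrMr ?expR_gt0//.
  have : 8 * (2 * m%:R + 1) / sigma <= expR L.
    by apply: le_trans (ltW expL); rewrite /L; lra.
  by rewrite ler_pdivrMr//; lra.
(* A lower bound, for all [t <= 1], on the strict margin [lam * expR (lam * (tau - t))], independent
   of [eps] and [N]. *)
pose kappa := lam * expR (lam * (tau - 1)).
have kappa0 : 0 < kappa by rewrite mulr_gt0 ?expR_gt0.
(* The bound on [C ^+ 2 * eps] is spent when [t = 1], the one on [4 * M * eps] when [k = 0];
   [eps <= sigma / 8] controls the cost of replacing [y] by [x]. *)
have [eps [eps0 eps1 eps2 eps3 eps4]] : exists eps, [/\ 0 < eps, eps <= 1,
    eps <= sigma / 8, C ^+ 2 * eps <= sigma / 8 & 4 * M * eps <= eta ^+ 2].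
  near (0 : R)^'+ => e; exists e; split.
  - by [].
  - by near: e; exact: nbhs_right_le.
  - by near: e; exact: nbhs_right_le.
  - by near: e; exact: near0_mul_le.
  - by near: e; apply: near0_mul_le; rewrite exprn_gt0.
pose A := (2 * eps)^-1 * (m%:R * C ^+ 2 + 1) + 1.
have : \forall x \near (0 : R)^'+, [/\ 0 < x, x <= 1, C * x <= sigma / 8,
    (2 * eps)^-1 * x <= sigma / 16 & x <= sigma / 16] /\ A * x <= kappa / 2.
  near=> e; split; first split.
  - by [].
  - by near: e; exact: nbhs_right_le.
  - by near: e; exact: near0_mul_le.
  - by near: e; exact: near0_mul_le.
  - by near: e; exact: nbhs_right_le.
  - by near: e; apply: near0_mul_le; lra.
move=> /near_infty_inv; apply: filterS => N [N0].
set h : R := N%:R^-1 => -[[h0 h1 hC heps h16] hA].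
have hh : h ^+ 2 <= h by rewrite expr2 ler_piMr// ltW.
have heps2 : (2 * eps)^-1 * h ^+ 2 <= sigma / 16.
  by apply: le_trans heps; rewrite ler_wpM2l// invr_ge0; lra.
rewrite leNgt; apply/negP => gap.
have [k0 k0N k0t] : exists2 k, (k <= N)%N & `|2 * tau - (1 - k%:R / N%:R)| <= h.
  by apply: grid_point => //; lra.
have U_k0 : U N k0 0 <= U N N 0 + sigma / 4.
  have := U_time_le N (N - k0) k0 0 N0; rewrite subnKC// => /lerNnormlW.
  have : (N - k0)%:R / N%:R * C <= sigma / 4.
    rewrite natrB// mulrBl divff ?pnatr_eq0 ?gtn_eqF// -/h.
    have kh : 1 - k0%:R * h <= 2 * tau + h.
      by move: k0t; rewrite ler_norml -/h; lra.
    by have := ler_wpM2r C0 kh; lra.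
  by lra.
(* Of the assumed gap [sigma], delaying [V] loses [sigma / 8], delaying [U] loses [sigma / 4], the
   penalty takes [sigma / 16] and the barrier [sigma / 8]. *)
have pen0 : 7 / 16 * sigma <= penalized N eps lam tau (0, 2 * tau) 0 k0.
  rewrite /penalized.
  have quad0 : quad eps ((0 : 'rV[R]_m), 2 * tau) 0 (1 - k0%:R / N%:R) <= sigma / 16.
    apply: le_trans heps2; rewrite /quad/= big1 ?add0r; last first.
      by move=> i _; rewrite mxE subrr expr0n mulr0.
    rewrite ler_wpM2l ?invr_ge0//; first by lra.
    by rewrite -real_normK ?num_real// lerXn2r ?nnegrE// ltW.
  have barrier0 : barrier C lam tau ((0 : 'rV[R]_m), 2 * tau) <= sigma / 8.
    apply: le_trans expNL; rewrite /barrier/=.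
    have -> : (2 * m%:R + 1) * expR (- L) = \sum_(i < m) expR (- L) +
        \sum_(i < m) expR (- L) + expR (- L).
      by rewrite sumr_const card_ord -[_ *+ m]mulr_natl; ring.
    have Ct : 0 <= C * (2 * tau) by rewrite mulr_ge0//; lra.
    have z0 i : (0 : 'rV[R]_m) 0 i = 0 :> R by rewrite mxE.
    rewrite !lerD//; do ?[apply: ler_sum => i _];
      rewrite ler_expR ?z0 -lamtau -(mulrN lam) ler_pM2l//; last by lra.
      by lra.
    by lra.
  have V0 : clampV (0, 0) = V 0 0 by rewrite clampV_id// lexx ler01.
  by move: tauV; rewrite ltr_norml V0; lra.
have U_lower x k : (k <= N)%N -> g x <= U N k x + C.
  move=> kN; have := U_ge_term N k x N0.
  suff : k%:R / N%:R * C <= C by lra.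
  by rewrite ler_piMl// ler_pdivrMr ?ltr0n// mul1r ler_nat.
have gM z : box tau z -> `|g z.1| <= M.
  move=> /boxP[zx _]; rewrite -clampV_term; apply: VM; apply/boxP; split=> //=.
  by rewrite ler01 lexx.
have pen_le z y k : box tau z -> (k <= N)%N ->
    penalized N eps lam tau z y k <= 2 * M + C + 1 - barrier C lam tau z.
  move=> bz kN; apply: le_trans (penalized_le _ _ _ _ _ _ _ N0 eps0) _.
  have : 0 <= (2 * eps)^-1 * (z.2 - (1 - k%:R / N%:R)) ^+ 2.
    by rewrite mulr_ge0 ?sqr_ge0// invr_ge0; lra.
  have := U_lower z.1 k kN; have := gM _ bz; have := VM _ bz.
  by rewrite !ler_norml; lra.
have b_t : box tau (0, 2 * tau) by apply: box0; lra.
have [[x t] [y [k [bz kN z_max all_max]]]] :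
    exists z y k, [/\ box tau z, (k <= N)%N,
    (forall z', box tau z' ->
       penalized N eps lam tau z' y k <= penalized N eps lam tau z y k) &
    (forall z' y' k', box tau z' -> (k' <= N)%N ->
       penalized N eps lam tau z' y' k' <=
       penalized N eps lam tau z y k + h ^+ 2)].
  apply: (penalized_max N eps lam tau (2 * M + C + 1) N0); first by exists (0, 2 * tau).
  move=> z y k bz kN; apply: le_trans (pen_le z y k bz kN) _.
  by rewrite gerBl barrier_ge0.
(* The loss from [7 / 16] to [6 / 16] is the tolerance [h ^+ 2 <= sigma / 16]. *)
have pen_pos : 3 / 8 * sigma <= penalized N eps lam tau (x, t) y k.
  by have := all_max _ 0 k0 b_t k0N; lra.
have pen_up := penalized_le N eps lam tau (x, t) y k N0 eps0.
have b0 := barrier_ge0 R m C lam tau (x, t).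
rewrite /= in pen_up.
have barrier_le : barrier C lam tau (x, t) < expR L.
  have := pen_le _ y k bz kN; move: expL; rewrite /L; lra.
have [x_in t01] := (boxP _ _).1 bz; rewrite /= in x_in t01.
have ltL c : (L <= lam * c) = (tau <= c) by rewrite -lamtau ler_pM2l.
have x_int i : - (2 * tau) < x 0 i < C + 2 * tau.
  have /andP[xl xu] := x_in i; have /andP[t0 t1] := t01.
  rewrite lt_neqAle xl andbT lt_neqAle xu andbT.
  apply/andP; split; apply/eqP => x_bd.
    suff : expR L <= barrier C lam tau (x, t) by rewrite leNgt barrier_le.
    apply: barrier_ge; right; left; exists i; rewrite ltL/= -x_bd; lra.
  suff : expR L <= barrier C lam tau (x, t) by rewrite leNgt barrier_le.
  apply: barrier_ge; left; exists i; rewrite ltL/= x_bd.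
  by have := ler_wpM2l C0 t1; lra.
have t_pos : 0 < t.
  have /andP[t0 t1] := t01; rewrite lt_neqAle t0 andbT; apply/eqP => t_bd.
  suff : expR L <= barrier C lam tau (x, t) by rewrite leNgt barrier_le.
  by apply: barrier_ge; right; right; rewrite ltL/= -t_bd; lra.
(* At [t = 1], [V] equals [g] and [U] lies below [g] by at most [C * (k / N)]. Young's inequality
   pays for this with the time part of [quad], which is then [(2 * eps)^-1 * (k / N) ^+ 2]. *)
have t_lt1 : t < 1.
  have /andP[t0 t1] := t01; rewrite lt_neqAle t1 andbT; apply/eqP => t_bd.
  move: pen_up; rewrite t_bd clampV_term opprB addrCA subrr addr0.
  have := U_ge_term N k x N0.
  have := young eps C (k%:R / N%:R) eps0.
  rewrite [C * _]mulrC.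
  by move: pen_pos b0; rewrite t_bd; lra.
(* The scheme inequality needs a successor index, so [k = 0] is excluded first: either [V] exceeds
   [g] by less than [sigma / 8], or [t] stays [eta] away from [1] and the penalty is at least
   [2 * M]. *)
case: k => [|k] in kN z_max all_max pen_pos pen_up *.
  move: pen_up; rewrite mul0r subr0 U_term.
  have : 0 <= (2 * eps)^-1 * (t - 1) ^+ 2.
    by rewrite mulr_ge0 ?sqr_ge0// invr_ge0; lra.
  have [small|big] := ltP (clampV (x, t) - g x) (sigma / 8); first by lra.
  have eta_le := etaP _ bz big; rewrite /= in eta_le.
  have : 2 * M <= (2 * eps)^-1 * (t - 1) ^+ 2.
    rewrite [leRHS]mulrC ler_pdivlMr ?mulr_gt0//.
    have : eta ^+ 2 <= (1 - t) ^+ 2 by rewrite lerXn2r ?nnegrE//; lra.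
    by rewrite -[(t - 1) ^+ 2]sqrrN opprB; lra.
  have := gM _ bz; have := VM _ bz; rewrite !ler_norml /=; lra.
have t01' : 0 < t < 1 by rewrite t_pos.
have visc : lam * expR (lam * (tau - t)) <=
    eps^-1 * (t - (1 - k.+1%:R / N%:R)) + H (eps^-1 *: (x - y)).
  apply: viscosity_at_max => //.
  (* At an interior point the maximum over the box is a local one, and clamping has no effect
     nearby. *)
  have near_box := box_nbhs tau x t x_int t01'.
  apply: filterS near_box => -[x' t'] bz'.
  have [_ /= t01''] := (boxP _ _).1 bz'.
  have := z_max _ bz'.
  by rewrite /penalized /= !clampV_id//; lra.
have := scheme_at_max N k eps x y t N0 eps0.
rewrite -/h -/A => /(_ _)/(le_trans visc) key.
suff : kappa <= h * A.
  by rewrite [h * A]mulrC; lra.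
apply: le_trans (key _).
  by rewrite ler_pM2l// ler_expR ler_pM2l//; lra.
move=> y'.
have := all_max _ y' k bz (ltnW kN).
by rewrite /penalized; lra.
Unshelve. all: by end_near. Qed.

End Comparison.

(** * Bounds on the Kullback-Leibler divergence *)

Section KLBounds.
Variables (R : realType) (X : finType).
Implicit Types (q nu : X -> R).

Lemma is_dist_le1 (T : finType) (p : T -> R) x : is_dist p -> p x <= 1.
Proof.
move=> [p0 <-]; rewrite (bigD1 x)//= lerDl sumr_ge0// => y _; exact: p0.
Qed.

(** Gibbs' inequality: [ln u <= u - 1] at [u = nu x / q x] makes each term at least [q x - nu x],
    and these differences sum to zero. *)
Lemma KL_ge0 q nu : is_dist q -> is_dist nu -> (forall x, 0 < nu x) ->
  0 <= KL q nu.
Proof.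
move=> [q0 q1] [_ nu1] nu0.
have <- : \sum_x (q x - nu x) = 0 by rewrite sumrB q1 nu1 subrr.
apply: ler_sum => x _; case: eqP => [->|/eqP qx0].
  by rewrite sub0r oppr_le0 ltW.
have qx : 0 < q x by rewrite lt_neqAle eq_sym qx0 q0.
have nq : 0 < nu x / q x by exact: divr_gt0.
have -> : q x / nu x = (nu x / q x)^-1 by rewrite invf_div.
rewrite lnV ?posrE//.
have ln_le : ln (nu x / q x) <= nu x / q x - 1.
  rewrite -[X in ln X](subrK 1) addrC; apply: le_ln1Dx; lra.
have := ler_wpM2l (ltW qx) ln_le.
have -> : q x * (nu x / q x - 1) = nu x - q x by field; rewrite gt_eqF.
by lra.
Qed.

(** Each ratio [q x / nu x] is at most [eps^-1], and the weights [q x] sum to one. *)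
Lemma KL_le q nu (eps : R) : 0 < eps -> is_dist q ->
  (forall x, eps <= nu x) -> KL q nu <= ln eps^-1.
Proof.
move=> eps0 dq nueps; have [q0 q1] := dq.
rewrite -[ln _]mul1r -q1 mulr_suml; apply: ler_sum => x _.
case: eqP => [->|/eqP qx0]; first by rewrite mul0r.
have qx : 0 < q x by rewrite lt_neqAle eq_sym qx0 q0.
have nx : 0 < nu x by exact: lt_le_trans (nueps x).
rewrite ler_pM2l// ler_ln ?posrE ?invr_gt0 ?divr_gt0//.
rewrite -[eps^-1]mul1r ler_pM ?invr_ge0 ?(ltW nx)//.
  exact: is_dist_le1.
by rewrite lef_pV2 ?posrE.
Qed.

End KLBounds.

(** * The terminal function as the payoff of a best decision *)

Section Terminal.
Variables (R : realType) (m : nat).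
Hypothesis m2 : (2 <= m)%N.
Implicit Types (x y : 'rV[R]_m) (j : 'I_m).

Definition min_but x j : R := inf [set v | exists i : 'I_m, i != j /\ v = x 0 i].

(** Makes the set under the infimum in [min_but] nonempty, so that the infimum is not a default
    value. *)
Lemma exists_other j : exists i : 'I_m, i != j.
Proof.
case: m m2 j => [|[|n]]// _ j.
by have [->|j0] := eqVneq j ord0; [exists ord_max|exists ord0; rewrite eq_sym].
Qed.

Lemma min_but_le x j i : i != j -> min_but x j <= x 0 i.
Proof.
move=> ij; apply: ge_inf; last by exists i.
exists (- \sum_(i < m) `|x 0 i|) => _ [k [_ ->]].
rewrite lerNl; apply: (@le_trans _ _ `|x 0 k|); first by rewrite -normrN ler_norm.
by rewrite (bigD1 k)//= lerDl sumr_ge0.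
Qed.

Lemma min_but_ge x j c : (forall i, i != j -> c <= x 0 i) -> c <= min_but x j.
Proof.
move=> cx; apply: lb_le_inf; last by move=> _ [i [ij ->]]; exact: cx.
by have [i ij] := exists_other j; exists (x 0 i), i.
Qed.

Lemma min_but_le_gterm x j : min_but x j <= gterm x.
Proof.
apply: ub_le_sup; last by exists j.
exists (\sum_(i < m) `|x 0 i|) => _ [k ->].
have [i ik] := exists_other k; apply: le_trans (min_but_le x k i ik) _.
by apply: le_trans (ler_norm _) _; rewrite (bigD1 i)//= lerDl sumr_ge0.
Qed.

(** There are finitely many decisions; the maximiser later supplies the decision rule [J]. *)
Lemma gterm_attained x : exists j, gterm x = min_but x j.
Proof.
have j0 : 'I_m := Ordinal (ltnW m2).
have [j _ j_max] := @arg_maxP _ _ _ j0 predT (min_but x) isT.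
exists j; apply/eqP; rewrite eq_le min_but_le_gterm andbT.
apply: ge_sup; first by exists (min_but x j), j.
by move=> _ [k ->]; exact: j_max.
Qed.

Lemma gterm_lip x y c :
  (forall i, x 0 i <= y 0 i + c) -> gterm x <= gterm y + c.
Proof.
move=> xy; have [j ->] := gterm_attained x.
apply: (@le_trans _ _ (min_but y j + c)); last by rewrite lerD2r min_but_le_gterm.
rewrite -lerBlDr; apply: min_but_ge => i ij; rewrite lerBlDr.
exact: le_trans (min_but_le _ _ _ ij) (xy i).
Qed.

End Terminal.

(** * The bandit problem as an instance of the abstract game *)

Section GameValue.
Variables (R : realType) (X : finType) (m K : nat).
Variables (nu : 'I_m -> 'I_K -> X -> R) (eps : R).
Hypotheses (m2 : (2 <= m)%N) (K0 : (0 < K)%N) (eps0 : 0 < eps).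
Hypothesis nu_dist : forall i a, is_dist (nu i a).
Hypothesis nu_ge : forall i a x, eps <= nu i a x.

Let C : R := ln eps^-1.
Let i0 : 'I_m := Ordinal (ltnW m2).
Let a0 : 'I_K := Ordinal K0.

Definition dist_profile (Q : profile R X K) : Prop := forall a, is_dist (Q a).

Definition KL_drift (Q : profile R X K) (w : 'I_K -> R) : 'rV[R]_m :=
  \row_i \sum_(a < K) w a * KL (Q a) (nu i a).

Let w0 : 'I_K -> R := fun a => (a == a0)%:R.

Lemma dist_profile_nu : dist_profile (nu i0).
Proof. by move=> a; exact: nu_dist. Qed.

Lemma is_dist_w0 : is_dist w0.
Proof.
split=> [a|]; first by rewrite ler0n.
by rewrite (bigD1 a0)//= /w0 eqxx big1 ?addr0// => a /negbTE ->.
Qed.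

Lemma KL_itv Q i a : dist_profile Q -> 0 <= KL (Q a) (nu i a) <= C.
Proof.
move=> dQ; apply/andP; split; last by apply: KL_le => //; exact: dQ.
by apply: KL_ge0 => // x; exact: lt_le_trans eps0 (nu_ge _ _ _).
Qed.

Lemma C_ge0 : 0 <= C.
Proof. by have /andP[] := KL_itv _ i0 a0 dist_profile_nu; exact: le_trans. Qed.

Lemma KL_drift_cube Q w : dist_profile Q -> is_dist w ->
  cube R m C (KL_drift Q w).
Proof.
move=> dQ [w_ge0 w1] i; rewrite mxE; apply/andP; split.
  by apply: sumr_ge0 => a _; rewrite mulr_ge0//; have /andP[] := KL_itv Q i a dQ.
rewrite -[leRHS]mul1r -w1 mulr_suml; apply: ler_sum => a _.
by apply: ler_wpM2l => //; have /andP[] := KL_itv Q i a dQ.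
Qed.

Let ham := hamiltonian R m (profile R X K) ('I_K -> R) dist_profile
  (@is_dist R 'I_K) KL_drift.

Lemma Ham_hamiltonian : Ham nu = ham.
Proof.
apply/funext => p.
have E Q w : \sum_(i < m) \sum_(a < K) w a * KL (Q a) (nu i a) * p 0 i =
    \sum_(i < m) KL_drift Q w 0 i * p 0 i.
  by apply: eq_bigr => i _; rewrite mxE mulr_suml.
have F Q : sup [set s | exists w, is_dist w /\
      s = \sum_(i < m) \sum_(a < K) w a * KL (Q a) (nu i a) * p 0 i] =
    sup [set s | exists w, is_dist w /\
      s = \sum_(i < m) KL_drift Q w 0 i * p 0 i].
  by congr sup; apply/seteqP; split=> s [w [dw ->]]; exists w; rewrite E.
by congr inf; apply/seteqP; split=> h [Q [dQ ->]]; exists Q; rewrite F.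
Qed.

Definition game_value (N : nat) : nat -> 'rV[R]_m -> R :=
  value R m (profile R X K) ('I_K -> R) dist_profile (@is_dist R 'I_K)
    KL_drift (@gterm R m) N%:R^-1.

Let path_state (N : nat) (r : seq (profile R X K) -> 'I_K -> R) :=
  state R m (profile R X K) ('I_K -> R) KL_drift (nu i0) N%:R^-1 r 0.

Lemma path_stateE N r (Qp : 'I_N -> profile R X K) i :
  path_state N r [seq Qp j | j <- enum 'I_N] 0 i =
  N%:R^-1 * \sum_(l < N) \sum_(a < K)
    r (take l.+1 [seq Qp j | j <- enum 'I_N]) a * KL (Qp l a) (nu i a).
Proof.
rewrite /path_state /state add0r mxE; congr (_ * _).
rewrite size_map size_enum_ord summxE; apply: eq_bigr => l _.
by rewrite mxE (nth_map l) ?size_enum_ord// nth_ord_enum.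
Qed.

Lemma min_but_path N r (Qp : 'I_N -> profile R X K) j :
  inf [set d | exists i : 'I_m, i != j /\
    d = N%:R^-1 * \sum_(l < N) \sum_(a < K)
      r (take l.+1 [seq Qp j | j <- enum 'I_N]) a * KL (Qp l a) (nu i a)] =
  min_but R m (path_state N r [seq Qp j | j <- enum 'I_N]) j.
Proof.
congr inf; apply/seteqP; split=> d [i [ij ->]]; exists i; split=> //;
  by rewrite path_stateE.
Qed.

Lemma path_payoff_ge0 N r (Qp : 'I_N -> profile R X K) j :
  (forall s, is_dist (r s)) -> (forall l, dist_profile (Qp l)) ->
  0 <= min_but R m (path_state N r [seq Qp j | j <- enum 'I_N]) j.
Proof.
move=> dr dQ; apply: min_but_ge => // i _; rewrite path_stateE.
rewrite mulr_ge0 ?invr_ge0//; apply: sumr_ge0 => l _; apply: sumr_ge0 => a _.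
have [r0 _] := dr (take l.+1 [seq Qp j | j <- enum 'I_N]).
by rewrite mulr_ge0//; have /andP[] := KL_itv _ i a (dQ l).
Qed.

(** The adversary's near-optimal path against [r] brings [gterm] of the final state down to the game
    value, and [gterm] dominates the payoff of every decision, whatever [J] is. *)
Lemma strategy_payoff_le N (r : seq (profile R X K) -> 'I_K -> R)
    (J : ('I_N -> profile R X K) -> 'I_m) : (0 < N)%N ->
  (forall s, is_dist (r s)) ->
  inf [set u | exists Qp : 'I_N -> profile R X K,
    (forall l a, is_dist (Qp l a)) /\
    u = inf [set d | exists i : 'I_m, i != J Qp /\
      d = N%:R^-1 * \sum_(l < N) \sum_(a < K)
        r (take l.+1 [seq Qp j | j <- enum 'I_N]) a * KL (Qp l a) (nu i a)]]
  <= game_value N N 0.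
Proof.
move=> N0 dr; apply/ler_addgt0Pr => e e0.
have N0' : 0 < N%:R :> R by rewrite ltr0n.
have h0 : 0 < N%:R^-1 :> R by rewrite invr_gt0.
(* An error of [e / N] in each of the [N] rounds adds up to [e]. *)
have eN : 0 < e / N%:R by exact: divr_gt0.
have [l [sl Pl le_l]] := value_adversary R m (profile R X K) ('I_K -> R)
  dist_profile (@is_dist R 'I_K) KL_drift C (nu i0) w0 C_ge0 dist_profile_nu
  is_dist_w0 KL_drift_cube (@gterm R m) _ h0 (gterm_lip R m m2) N 0 _ r eN dr.
pose Qp (j : 'I_N) := nth (nu i0) l j.
have lE : [seq Qp j | j <- enum 'I_N] = l.
  by rewrite -[RHS](mkseq_nth (nu i0)) sl /mkseq -val_enum_ord -map_comp.
have dQp (j : 'I_N) : dist_profile (Qp j) by apply: Pl; rewrite sl.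
apply: (@le_trans _ _ (min_but R m (path_state N r l) (J Qp))).
  apply: ge_inf; last first.
    by exists Qp; split; [exact: dQp|rewrite min_but_path lE].
  exists 0 => _ [Q [dQ ->]]; rewrite min_but_path.
  exact: path_payoff_ge0.
apply: le_trans (min_but_le_gterm _ _ m2 _ _) _.
by apply: le_trans le_l _; rewrite mulrC divfK ?gt_eqF.
Qed.

(** The upper bound holds for each pair of rules; for the lower one, a near-optimal allocation rule
    is paired with a decision rule maximising [min_but] at the final state. *)
Lemma Rgo_game_value N : (0 < N)%N -> Rgo nu N = game_value N N 0.
Proof.
move=> N0; apply/eqP; rewrite eq_le; apply/andP; split.
  apply: ge_sup; last by move=> _ [r [J [dr ->]]]; exact: strategy_payoff_le.
  by eexists; exists (fun _ => w0), (fun _ => i0); split;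
    [move=> s; exact: is_dist_w0|reflexivity].
apply/ler_addgt0Pr => e e0.
have N0' : 0 < N%:R :> R by rewrite ltr0n.
have h0 : 0 < N%:R^-1 :> R by rewrite invr_gt0.
have eN : 0 < e / N%:R by exact: divr_gt0.
have [r [dr r_ge]] := value_strategy R m (profile R X K) ('I_K -> R)
  dist_profile (@is_dist R 'I_K) KL_drift C (nu i0) w0 C_ge0 dist_profile_nu
  is_dist_w0 KL_drift_cube (@gterm R m) _ h0 (gterm_lip R m m2) N 0 _ eN.
have [J JE] := choice (fun Qp : 'I_N -> profile R X K =>
  gterm_attained R m m2 (path_state N r [seq Qp j | j <- enum 'I_N])).
rewrite -lerBlDr.
pose payoff := inf [set u | exists Qp : 'I_N -> profile R X K,
    (forall l a, is_dist (Qp l a)) /\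
    u = inf [set d | exists i : 'I_m, i != J Qp /\
      d = N%:R^-1 * \sum_(l < N) \sum_(a < K)
        r (take l.+1 [seq Qp j | j <- enum 'I_N]) a * KL (Qp l a) (nu i a)]].
apply: (@le_trans _ _ payoff); last first.
  (* A supremum dominates its members only if the set is bounded above; [strategy_payoff_le]
     supplies the bound. *)
  apply: ub_le_sup; last by exists r, J.
  exists (game_value N N 0) => _ [r' [J' [dr' ->]]].
  exact: strategy_payoff_le.
apply: lb_le_inf.
  eexists; exists (fun _ => nu i0); split; last reflexivity.
  by move=> _ a; exact: nu_dist.
move=> _ [Qp [dQ ->]]; rewrite min_but_path -JE.
have := r_ge [seq Qp j | j <- enum 'I_N].
rewrite size_map size_enum_ord [N%:R * _]mulrC divfK ?gt_eqF// => /(_ erefl).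
apply=> k; rewrite size_map size_enum_ord => kN.
by rewrite (nth_map (Ordinal kN)) ?size_enum_ord//; exact: dQ.
Qed.

Lemma game_value_time N k x : (0 < N)%N ->
  game_value N k x <= game_value N k.+1 x <= game_value N k x + N%:R^-1 * C.
Proof.
move=> N0; have h0 : 0 < N%:R^-1 :> R by rewrite invr_gt0 ltr0n.
exact: (value_time _ _ _ _ _ _ _ C (nu i0) w0 C_ge0 dist_profile_nu is_dist_w0
  KL_drift_cube _ _ h0 (gterm_lip R m m2)).
Qed.

Lemma game_value_ge_scheme N k y (p : 'rV[R]_m) c : (0 < N)%N ->
  (forall d, cube R m C d ->
    c + N%:R^-1 * (\sum_(i < m) d 0 i * p 0 i) <=
    game_value N k (y + N%:R^-1 *: d)) ->
  c + N%:R^-1 * ham p <= game_value N k.+1 y.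
Proof.
move=> N0; have h0 : 0 < N%:R^-1 :> R by rewrite invr_gt0 ltr0n.
exact: (value_ge_scheme _ _ _ _ _ _ _ C (nu i0) w0 C_ge0 dist_profile_nu
  is_dist_w0 KL_drift_cube _ _ h0 (gterm_lip R m m2)).
Qed.

Lemma game_value_le_scheme N k y (p : 'rV[R]_m) c : (0 < N)%N ->
  (forall d, cube R m C d ->
    game_value N k (y + N%:R^-1 *: d) <=
    c + N%:R^-1 * (\sum_(i < m) d 0 i * p 0 i)) ->
  game_value N k.+1 y <= c + N%:R^-1 * ham p.
Proof.
move=> N0; have h0 : 0 < N%:R^-1 :> R by rewrite invr_gt0 ltr0n.
exact: (value_le_scheme _ _ _ _ _ _ _ C (nu i0) w0 C_ge0 dist_profile_nu
  is_dist_w0 KL_drift_cube _ _ h0 (gterm_lip R m m2)).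
Qed.

Lemma game_value_lip N k (x y : 'rV[R]_m) c : (0 < N)%N ->
  (forall i, x 0 i <= y 0 i + c) -> game_value N k x <= game_value N k y + c.
Proof.
move=> N0; have h0 : 0 < N%:R^-1 :> R by rewrite invr_gt0 ltr0n.
exact: (value_lip _ _ _ _ _ _ _ C (nu i0) w0 C_ge0 dist_profile_nu is_dist_w0
  KL_drift_cube _ _ h0 (gterm_lip R m m2)).
Qed.

Lemma ham_lip (p q : 'rV[R]_m) :
  ham (p + q) <= ham p + C * \sum_(i < m) Num.max (q 0 i) 0.
Proof.
exact: (hamiltonian_lip _ _ _ _ _ _ _ C (nu i0) w0 dist_profile_nu is_dist_w0
  KL_drift_cube).
Qed.

Variable V : 'rV[R]_m -> R -> R.
Hypothesis V_sol : viscosity_solution (Ham nu) (@gterm R m) V.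

Lemma solution_le_Rgo sigma : 0 < sigma ->
  \forall N \near \oo, V 0 0 <= game_value N N 0 + sigma.
Proof.
have [V_cont [V_term [V_sub _]]] := V_sol.
apply: (subsolution_le_value R m ham (@gterm R m) C V game_value).
- exact: C_ge0.
- exact: ham_lip.
- exact: V_cont.
- exact: V_term.
- by rewrite -Ham_hamiltonian; exact: V_sub.
- move=> N k x y c N0 xy; apply: game_value_lip => // i.
  by have := le_trans (ler_norm _) (xy i); lra.
- move=> N k x N0; have := game_value_time N k x N0.
  by have := C_ge0; rewrite ler_norml; set a := N%:R^-1 * C; lra.
- by [].
- exact: game_value_ge_scheme.
Qed.

(* Negation turns the supersolution into a subsolution for the Hamiltonian
   [p |-> - ham (- p)]. *)
Lemma solution_ge_Rgo sigma : 0 < sigma ->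
  \forall N \near \oo, game_value N N 0 <= V 0 0 + sigma.
Proof.
move=> sigma0.
have [V_cont [V_term [_ V_super]]] := V_sol.
suff : \forall N \near \oo, - V 0 0 <= - game_value N N 0 + sigma.
  by apply: filterS => N; lra.
apply: (subsolution_le_value R m (fun p => - ham (- p))
  (fun x => - gterm x) C (fun x t => - V x t)
  (fun N k x => - game_value N k x)) => //.
- exact: C_ge0.
(* The one-sided bound survives negation because [- (p + q) + q] is [- p]. *)
- move=> p q; have := ham_lip (- (p + q)) q.
  by rewrite opprD subrK; lra.
- by move=> z; apply: cvgN; exact: V_cont.
- by move=> x; rewrite V_term.
- move=> phi C1phi x t t01 max_xt.
  have phiN := C1_withN _ _ _ _ (C1_C1_with _ _ _ C1phi).
  have := V_super _ (C1_with_C1 _ _ _ _ phiN) x t t01.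
  rewrite Ham_hamiltonian /d_t (C1_with_derive _ _ _ _ _ _ phiN).
  have -> : grad_x (fun z => - phi z) (x, t) = - grad_x phi (x, t).
    by apply/rowP => i; rewrite !mxE (C1_with_derive _ _ _ _ _ _ phiN).
  suff near_min : \forall z \near ((x, t) : 'rV[R]_m * R),
      V x t - - phi (x, t) <= V z.1 z.2 - - phi z.
    by move=> /(_ near_min); lra.
  by apply: filterS max_xt => z; lra.
- move=> N k x y c N0 xy.
  suff : game_value N k y <= game_value N k x + c by lra.
  apply: game_value_lip => // i.
  by have := lerNnormlW (xy i); lra.
- move=> N k x N0; have := game_value_time N k x N0.
  by have := C_ge0; rewrite ler_norml; set a := N%:R^-1 * C; lra.
- move=> N k y p c N0 cU.
  (* Negation turns the affine minorant of slope [p] into an affine majorant of slope [- p]. *)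
  suff : game_value N k.+1 y <= - c + N%:R^-1 * ham (- p) by lra.
  apply: game_value_le_scheme => // d /cU.
  have -> : \sum_(i < m) d 0 i * (- p) 0 i = - \sum_(i < m) d 0 i * p 0 i.
    by rewrite -sumrN; apply: eq_bigr => i _; rewrite mxE mulrN.
  by lra.
Qed.

End GameValue.

Theorem mainTheorem3 (R : realType) (X : finType) (m K : nat)
  (nu : 'I_m -> 'I_K -> X -> R) (eps : R) :
  (2 <= m)%N -> (0 < K)%N -> 0 < eps ->
  (forall i a, is_dist (nu i a)) ->
  (forall i a x, eps <= nu i a x) ->
  forall V : 'rV[R]_m -> R -> R,
    viscosity_solution (Ham nu) (@gterm R m) V ->
    (fun B : nat => Rgo nu B) @ \oo --> V 0 0.
Proof.
move=> m2 K0 eps0 nu_dist nu_ge V V_sol.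
apply/cvgrPdist_le => sigma sigma0; near=> N.
have N0 : (0 < N)%N by near: N; exact: nbhs_infty_gt.
rewrite (Rgo_game_value _ _ _ _ nu eps)// ler_distl; apply/andP; split.
  rewrite lerBlDr; near: N.
  exact: (solution_ge_Rgo _ _ _ _ nu eps).
by near: N; exact: (solution_le_Rgo _ _ _ _ nu eps).
Unshelve. all: by end_near. Qed.
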